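(* For all types $\sigma,\tau\Vdash n$, the coefficient of $p_{\tau}^{\otimes}$ in the $p^{\otimes}$-expansion of $P_{\sigma}$ is \[ \mathcal{M}(P,p^{\otimes})_{\tau,\sigma}=\sum_{T\in\mathrm{ICRPT}(\tau,\sigma)} \operatorname{wt}(T). \]
   Context: An integer partition is a finite (possibly empty) weakly decreasing sequence of positive integers. A block is an ordered pair of positive integers written $d^m$ (degree $d$, multiplicity $m$). Blocks are ordered by $a^b\ge d^e$ iff $a>d$, or $a=d$ and $b\ge e$. A type is a finite (possibly empty) weakly decreasing sequence of blocks $\tau=(d_1^{m_1},\dots,d_s^{m_s})$; its weight is $|\tau|=\sum_id_im_i$, and $\tau\Vdash n$ means $|\tau|=n$. For $k\ge1$, $\tau|_k$ denotes the integer partition formed by the multiplicities of the blocks of $\tau$ of degree $k$. The tensor diagram of $\tau$ is the sequence of partition diagrams $\mathrm{dg}(\tau|_1)\otimes\mathrm{dg}(\tau|_2)\otimes\cdots$; the $k$th component has rows (left-justified, longest at top) of lengths the parts of $\tau|_k$. Variables: $x_{k,j}$ for $k,j\ge 1$, with $\deg x_{k,j}=k$; $\mathbf{x}_{k*}=(x_{k,1},x_{k,2},\dots)$. The graded algebra $\mathsf{P\Lambda}=\bigoplus_n\mathsf{P\Lambda}^n$ of polysymmetric functions consists of the formal series over $\mathbb{Q}$ of bounded degree in all the $x_{k,j}$ that, for each fixed $k$, are unchanged by any permutation of the variables $\mathbf{x}_{k*}$. Define $p^{\otimes}_\tau=\prod_{k\ge1}p_{\tau|_k}(\mathbf{x}_{k*})$,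 where $p_\lambda$ is the power-sum symmetric function; $\{p^\otimes_\tau:\tau\Vdash n\}$ is a basis of $\mathsf{P\Lambda}^n$. Define $P_d=\sum_{k\mid d}k\sum_{j\ge1}x_{k,j}^{d/k}$, let $P_{d^m}$ be obtained from $P_d$ by replacing every variable $x_{k,j}$ by $x_{k,j}^m$, and set $P_\sigma=\prod_{i=1}^sP_{d_i^{m_i}}$ for $\sigma=(d_1^{m_1},\dots,d_s^{m_s})$. The transition matrix is defined by $P_\sigma=\sum_{\tau\Vdash n}\mathcal{M}(P,p^\otimes)_{\tau,\sigma}p^\otimes_\tau$ for $\sigma\Vdash n$. For $\sigma=(d_1^{m_1},\dots,d_s^{m_s})$, $\mathrm{ICRPT}(\tau,\sigma)$ is the set of increasing constant-row $P$-tableaux of shape $\tau$ and content $\sigma$: fillings $T$ of the cells of the tensor diagram of $\tau$ with integers $1,\dots,s$ such that: (i) each row of each component is constant; (ii) for $1\le i\le s$, exactly one row in the tensor diagram of $\tau$ contains the value $i$, and if that row lies in component $k$ and has length $r$, then $k$ divides $d_i$ and $rk=d_im_i$; (iii) for each $r,k$, the values in the rows of length $r$ in component $k$ weakly increase reading down the first column. The weight is $\operatorname{wt}(T)=\prod_{k\ge1}k^{n_k(T)}$, where $n_k(T)$ is the number of rows of component $k$ (all of which contain nonzero values). *)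

(* Defs.v *)
From HB Require Import structures.
From mathcomp Require Import all_boot all_order all_algebra finmap.
From mathcomp Require Import boolp classical_sets fsbigop.
From mathcomp Require Import monalg.

Set Implicit Arguments.
Unset Strict Implicit.
Unset Printing Implicit Defensive.

Import Order.TTheory GRing.Theory Num.Theory.

Local Open Scope classical_set_scope.
Local Open Scope ring_scope.

(* The block d^m is the pair (d, m): degree d, multiplicity m. *)
Definition block : Type := (nat * nat)%type.

Definition block_ge (b c : block) : bool :=
  ((c.1 < b.1) || ((b.1 == c.1) && (c.2 <= b.2)))%N.

Definition is_ptype (s : seq block) : bool :=
  all (fun b : block => (0 < b.1) && (0 < b.2))%N s && sorted block_ge s.

Record ptype : Type := PType { blocks :> seq block ; _ : is_ptype blocks }.

HB.instance Definition _ := [isSub for blocks].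
HB.instance Definition _ := [Choice of ptype by <:].

Definition weight (t : ptype) : nat := (\sum_(b <- blocks t) b.1 * b.2)%N.

Definition maxdeg (t : ptype) : nat := (\max_(b <- blocks t) b.1)%N.

(* The partition t|_k, listed in weakly decreasing order since the blocks of t
   are. *)
Definition restr (t : ptype) (k : nat) : seq nat :=
  [seq b.2 | b : block <- blocks t & b.1 == k].

(* The pair (a, b) is the variable x_{a+1,b+1}. *)
Definition var : choiceType := (nat * nat)%type.
Definition var_of (k j : nat) : var := (k.-1, j.-1).

Notation monomial := {cmonom var}.

Definition X (k j : nat) : monomial := ucm (var_of k j).

(* Formal series over Q in the x_{k,j}, as coefficient functions. *)
Definition series : Type := monomial -> rat.

Definition sone : series := fun u => (u == mone)%:R.

(* A monomial has finitely many factorizations, so the sum is finite. *)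
Definition smul (f g : series) : series := fun u =>
  \sum_(vw \in [set vw : monomial * monomial | mmul vw.1 vw.2 = u])
    f vw.1 * g vw.2.

(* p_r(x_{k*}), the sum over j >= 1 of x_{k,j} ^ r, for k, r >= 1; at most one
   j contributes to each coefficient. *)
Definition psum (k r : nat) : series := fun u =>
  \sum_(j \in [set j : nat | (0 < j)%N]) ((u == expcmn (X k j) r)%:R : rat).

Definition psum_part (k : nat) (la : seq nat) : series :=
  \big[smul/sone]_(r <- la) psum k r.

(* The components of degree k > maxdeg t are empty and contribute factors 1. *)
Definition p_tensor (t : ptype) : series :=
  \big[smul/sone]_(1 <= k < (maxdeg t).+1) psum_part k (restr t k).

(* P_d for d >= 1: psum k (d / k) is the sum over j of x_{k,j} ^ (d / k). *)
Definition P_deg (d : nat) : series := fun u =>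
  \sum_(k <- divisors d) k%:R * psum k (d %/ k) u.

(* The substitution of x_{k,j} ^ m for every x_{k,j}, for m >= 1: it carries
   the monomial v to v ^ m, and v |-> v ^ m is injective. *)
Definition subst_pow (m : nat) (f : series) : series := fun u =>
  \sum_(v \in [set v : monomial | expcmn v m = u]) f v.

Definition P_block (b : block) : series := subst_pow b.2 (P_deg b.1).

Definition P_ (s : ptype) : series :=
  \big[smul/sone]_(b <- blocks s) P_block b.

(* There are finitely many types of weight n, so the sum is finite. *)
Definition is_p_tensor_expansion (n : nat) (f : series) (c : ptype -> rat) :
    Prop :=
  forall u : monomial,
    f u = \sum_(t \in [set t : ptype | weight t = n]) c t * p_tensor t u.

(* M(P, p_tensor)_{t,s}: the coefficient of p_tensor t in the expansion of
   P_ s.  As the p_tensor t with weight t = n form a basis of the homogeneous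
   polysymmetric functions of degree n, the value at every t of weight
   n = weight s is determined by the expansion property. *)
Definition transition (t s : ptype) : rat :=
  xget (fun=> 0)
    [set c : ptype -> rat | is_p_tensor_expansion (weight s) (P_ s) c] t.

(* The rows of the tensor diagram: component k.+1, and position from the top
   in that component. *)
Definition trow (t : ptype) : finType :=
  {k : 'I_(maxdeg t) & 'I_(size (restr t k.+1))}.

Definition comp (t : ptype) (rho : trow t) : nat := (tag rho).+1.
Definition rowpos (t : ptype) (rho : trow t) : nat := tagged rho.
Definition rowlen (t : ptype) (rho : trow t) : nat :=
  nth 0%N (restr t (comp rho)) (rowpos rho).

Definition cell (t : ptype) : finType := {rho : trow t & 'I_(rowlen rho)}.

Definition cellrow (t : ptype) (x : cell t) : trow t := tag x.
Definition cellcol (t : ptype) (x : cell t) : nat := tagged x.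

(* The value i : 'I_(size s) stands for the integer i + 1 in 1, ..., size s. *)
Definition filling (t s : ptype) : finType :=
  {ffun cell t -> 'I_(size (blocks s))}.

Definition constant_rows (t s : ptype) (T : filling t s) : bool :=
  [forall x : cell t, forall y : cell t,
     (cellrow x == cellrow y) ==> (T x == T y)].

Definition rows_with (t s : ptype) (T : filling t s)
    (i : 'I_(size (blocks s))) : {set trow t} :=
  [set cellrow x | x : cell t & T x == i]%SET.

Definition has_content (t s : ptype) (T : filling t s) : bool :=
  [forall i : 'I_(size (blocks s)), exists rho : trow t,
     let: (d, m) := nth (0, 0)%N (blocks s) i in
     [&& rows_with T i == [set rho]%SET,
         (comp rho %| d)%N & (rowlen rho * comp rho == d * m)%N]].

Definition increasing (t s : ptype) (T : filling t s) : bool :=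
  [forall x : cell t, forall y : cell t,
     [&& cellcol x == 0, cellcol y == 0,
         comp (cellrow x) == comp (cellrow y),
         rowlen (cellrow x) == rowlen (cellrow y)
       & rowpos (cellrow x) <= rowpos (cellrow y)]%N
     ==> (T x <= T y)%N].

Definition ICRPT (t s : ptype) : {set filling t s} :=
  [set T : filling t s | [&& constant_rows T, has_content T & increasing T]]%SET.

(* Every entry is a positive integer, so n_k(T) counts all rows of
   component k. *)
Definition nrows (t s : ptype) (k : nat) (T : filling t s) : nat :=
  #|[set rho : trow t | comp rho == k]%SET|.

Definition wt (t s : ptype) (T : filling t s) : nat :=
  (\prod_(1 <= k < (maxdeg t).+1) k ^ nrows k T)%N.

(* Main.v *)
From HB Require Import structures.
From mathcomp Require Import all_boot all_order all_algebra finmap.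
From mathcomp Require Import boolp classical_sets cardinality fsbigop.
From mathcomp Require Import monalg.
Require Import Defs.

(** Write psum k r for the power sum p_r in the variables x_{k,1}, x_{k,2}, ...
    Every factor of P_sigma is a combination of such power sums: replacing each
    variable by its m-th power turns psum k r into psum k (r m), so

      P_{d^m} = sum over the divisors k of d of k * psum k (m d / k).

    Expanding the product over the blocks d_i^{m_i} of sigma gives one term for
    each choice kappa of a divisor kappa_i of every d_i ([P_expansion]). This
    term is (prod_i kappa_i) times the product of the psum kappa_i
    (m_i d_i / kappa_i), and a product of power sums over a list of blocks
    (k, r) is p_tensor of the type with these blocks ([p_tensorE]). Hence the
    coefficient of p_tensor tau is the sum of prod_i kappa_i over the choices
    kappa whose blocks are those of tau ([choice_coef_expansion]).

    To speak of the coefficient, the p_tensor must be linearly independent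
    ([p_tensor_free]). This is a triangularity argument. Give each block of t a
    variable of its own: this defines a monomial which has a positive
    coefficient in p_tensor t, and which occurs in p_tensor t' with t' <> t only
    if t' has more blocks than t.

    It remains to match the choices kappa with the tableaux ([sum_ICRPT]). A
    tableau is a bijection from the rows of the diagram of tau to the indices of
    the blocks of sigma, and its choice is the component of the row that
    contains i. The row of i then has length m_i d_i / kappa_i, so the choice has
    the blocks of tau; and the product of the kappa_i is the product over the
    rows of their components, which is the weight. Conversely kappa leaves open
    only how the rows of equal component and length are matched with the
    indices i of equal block (kappa_i, m_i d_i / kappa_i), and the increasing
    condition allows exactly one such matching ([order_match_exists] and
    [order_match_unique]). *)

Set Implicit Arguments.
Unset Strict Implicit.
Unset Printing Implicit Defensive.

Import Order.TTheory GRing.Theory Num.Theory.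

Local Open Scope classical_set_scope.
Local Open Scope ring_scope.

(** * The ring of formal series *)

Definition szero : series := fun=> 0.

Definition sadd (f g : series) : series := fun u => f u + g u.

Definition sscale (a : rat) (f : series) : series := fun u => a * f u.

Lemma saddA : associative sadd.
Proof. by move=> f g h; apply/funext => u; rewrite /sadd addrA. Qed.

Lemma saddC : commutative sadd.
Proof. by move=> f g; apply/funext => u; rewrite /sadd addrC. Qed.

Lemma sadd0 : left_id szero sadd.
Proof. by move=> f; apply/funext => u; rewrite /sadd add0r. Qed.

HB.instance Definition _ :=
  Monoid.isComLaw.Build series szero sadd saddA saddC sadd0.

Lemma sum_series (I : Type) (r : seq I) (P : pred I) (F : I -> series) u :
  (\big[sadd/szero]_(i <- r | P i) F i) u = \sum_(i <- r | P i) F i u.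
Proof.
by rewrite (big_morph (fun f : series => f u) (id1 := 0) (op1 := +%R)).
Qed.

Lemma divisors_finite (u : monomial) :
  finite_set [set v : monomial | forall i, (v i <= u i)%N].
Proof.
pose N := (\max_(i <- finsupp u) u i)%N.
pose box (f : {ffun finsupp u -> 'I_N.+1}) : monomial :=
  [cmonom (f i : nat) | i : finsupp u]%M.
apply: (@sub_finite_set _ _
  [set box f | f in [set: {ffun finsupp u -> 'I_N.+1}]]);
  last exact/finite_image/finite_finset.
move=> v /= le_vu; exists [ffun i => inord (v (val i))] => //.
apply/eqP/cmP => i; rewrite cmE fsfun_ffun.
case: insubP => [j _ <-|i_notin] /=; last first.
  have := le_vu i; rewrite (fsfun_dflt i_notin) leqn0 => /eqP-> //.
rewrite ffunE inordK // ltnS (leq_trans (le_vu _)) //.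
exact: leq_bigmax_seq (valP j) _.
Qed.

Definition factors (u : monomial) : {fset monomial} :=
  fset_set [set v : monomial | forall i, (v i <= u i)%N].

Lemma in_factors (u v : monomial) : reflect (forall i, (v i <= u i)%N) (v \in factors u).
Proof.
by rewrite in_fset_set; [apply: (iffP idP); rewrite in_setE | exact: divisors_finite].
Qed.

Lemma factors_mull (u v w : monomial) : mmul v w \in factors u -> v \in factors u.
Proof.
move=> /in_factors le_vw; apply/in_factors => i.
by rewrite (leq_trans _ (le_vw i)) // cmM leq_addr.
Qed.

Lemma factors_mulr (u v w : monomial) : mmul v w \in factors u -> w \in factors u.
Proof. by rewrite mulmC; exact: factors_mull. Qed.

Lemma factors_refl (u : monomial) : u \in factors u.
Proof. exact/in_factors. Qed.

(** The set of factors of u is finite and closed under taking factors, so the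
    products at u and at all its factors are double sums over one finite
    range. The ring laws then reduce to exchanging finite sums. *)
Lemma smulE (f g : series) (x u : monomial) : x \in factors u ->
  smul f g x = \sum_(v <- factors u) \sum_(w <- factors u)
    if mmul v w == x then f v * g w else 0.
Proof.
move=> xu.
rewrite /smul (fsbigE [seq vw <- [seq (v, w) | v <- factors u, w <- factors u]
  | mmul vw.1 vw.2 == x]); first last.
- move=> [v w] /= vwx; rewrite mem_filter /= vwx eqxx /=.
  by rewrite allpairs_f //; [apply: (@factors_mull _ _ w) | apply: (@factors_mulr _ v)];
    rewrite vwx.
- by move=> [v w] /=; rewrite mem_filter => /andP[/eqP].
- by rewrite filter_uniq // allpairs_uniq // => -[? ?] [? ?].
rewrite big_filter_cond big_mkcond big_allpairs_dep /=.
apply: eq_bigr => v _; apply: eq_bigr => w _.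
by case: eqP => //= vwx; rewrite ifT // in_setE.
Qed.

Lemma smulC : commutative smul.
Proof.
move=> f g; apply/funext => u.
rewrite !(smulE _ _ (factors_refl u)) exchange_big /=.
by apply: eq_bigr => v _; apply: eq_bigr => w _; rewrite mulmC mulrC.
Qed.

Lemma smul1 : left_id sone smul.
Proof.
move=> f; apply/funext => u; rewrite (smulE _ _ (factors_refl u)).
have f1 : mone \in factors u.
  by apply: (@factors_mull _ _ u); rewrite mul1m factors_refl.
rewrite (big_fsetD1 mone) //= [X in _ + X]big1_seq; last first.
  move=> v /=; rewrite in_fsetD1 => /andP[v1 _]; apply: big1 => w _.
  by rewrite /sone (negPf v1) mul0r if_same.
rewrite addr0 (big_fsetD1 u) ?factors_refl //= [X in _ + X]big1_seq; last first.
  by move=> v /=; rewrite in_fsetD1 mul1m eq_sym => /andP[/negPf-> _].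
by rewrite mul1m eqxx addr0 /sone eqxx mul1r.
Qed.

Lemma smulA : associative smul.
Proof.
(* Both bracketings are the sum over the factorizations u = a b c. *)
have triple f g h u : smul (smul f g) h u =
  \sum_(a <- factors u) \sum_(b <- factors u) \sum_(c <- factors u)
    if mmul (mmul a b) c == u then f a * g b * h c else 0.
  rewrite (smulE _ _ (factors_refl u)).
  transitivity (\sum_(v <- factors u) \sum_(c <- factors u)
     \sum_(a <- factors u) \sum_(b <- factors u)
      if (mmul v c == u) && (mmul a b == v) then f a * g b * h c else 0).
    apply: eq_big_seq => v vu; apply: eq_bigr => c _.
    case: eqP => _ /=; last by rewrite big1 // => a _; rewrite big1.
    rewrite (smulE _ _ vu) mulr_suml; apply: eq_bigr => a _.
    rewrite mulr_suml; apply: eq_bigr => b _; case: ifP => // _; exact: mul0r.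
  rewrite exchange_big /=.
  under eq_bigr do (rewrite exchange_big /=; under eq_bigr do rewrite exchange_big /=).
  rewrite exchange_big /=; apply: eq_bigr => a _.
  rewrite exchange_big /=; apply: eq_bigr => b _; apply: eq_bigr => c _.
  case: eqP => abc; last first.
    rewrite big1 // => v _; case: andP => // -[/eqP vc /eqP ab].
    by case: abc; rewrite ab.
  have abu : mmul a b \in factors u.
    by apply: (@factors_mull _ _ c); rewrite abc factors_refl.
  rewrite (big_fsetD1 (mmul a b)) //= abc !eqxx /= big1_seq ?addr0 // => v /=.
  by rewrite in_fsetD1 eq_sym => /andP[/negPf-> _]; rewrite andbF.
move=> f g h; apply/funext => u; rewrite smulC !triple.
under eq_bigr do rewrite exchange_big /=.
rewrite exchange_big /=; apply: eq_bigr => a _; apply: eq_bigr => b _; apply: eq_bigr => c _.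
have -> : mmul (mmul b c) a = mmul (mmul a b) c by rewrite mulmC mulmA.
by case: ifP => // _; rewrite mulrC mulrA.
Qed.

Lemma smul_addl : left_distributive smul sadd.
Proof.
move=> f g h; apply/funext => u; rewrite /sadd !(smulE _ _ (factors_refl u)).
rewrite -big_split /=; apply: eq_bigr => v _.
rewrite -big_split /=; apply: eq_bigr => w _.
by case: ifP => _; rewrite ?mulrDl ?addr0.
Qed.

Lemma smul_addr : right_distributive smul sadd.
Proof. by move=> f g h; rewrite smulC smul_addl !(smulC _ f). Qed.

Lemma smul0 : left_zero szero smul.
Proof.
move=> f; apply/funext => u; rewrite (smulE _ _ (factors_refl u)).
by rewrite big1 // => v _; rewrite big1 // => w _; rewrite mul0r if_same.
Qed.

Lemma smulr0 : right_zero szero smul.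
Proof. by move=> f; rewrite smulC smul0. Qed.

HB.instance Definition _ :=
  Monoid.isComLaw.Build series sone smul smulA smulC smul1.
HB.instance Definition _ := Monoid.isMulLaw.Build series szero smul smul0 smulr0.
HB.instance Definition _ := Monoid.isAddLaw.Build series smul sadd smul_addl smul_addr.

Lemma smul_scale (a b : rat) (f g : series) :
  smul (sscale a f) (sscale b g) = sscale (a * b) (smul f g).
Proof.
apply/funext => u; rewrite /sscale !(smulE _ _ (factors_refl u)) mulr_sumr.
apply: eq_bigr => v _; rewrite mulr_sumr; apply: eq_bigr => w _.
by case: ifP => _; rewrite ?mulr0 // mulrACA.
Qed.

Lemma prod_scale (I : Type) (r : seq I) (a : I -> rat) (f : I -> series) :
  \big[smul/sone]_(i <- r) sscale (a i) (f i) =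
  sscale (\prod_(i <- r) a i) (\big[smul/sone]_(i <- r) f i).
Proof.
elim: r => [|i r IH]; last by rewrite !big_cons IH smul_scale.
by rewrite !big_nil; apply/funext => u; rewrite /sscale mul1r.
Qed.

Lemma smul_ge0 (f g : series) : (forall u, 0 <= f u) -> (forall u, 0 <= g u) ->
  forall u, 0 <= smul f g u.
Proof. by move=> f0 g0 u; apply: fsumr_ge0 => vw _; rewrite mulr_ge0. Qed.

Lemma smul_neq0 (f g : series) u : smul f g u != 0 ->
  exists v w : monomial, [/\ u = mmul v w, f v != 0 & g w != 0].
Proof.
move=> fgu.
have [[v w] /= vwu] := @fsbigN1 _ _ +%R _ _ _
  (fun (_ : unit) (vw : monomial * monomial) => f vw.1 * g vw.2) tt fgu.
by rewrite mulf_eq0 negb_or => /andP[fv gw]; exists v, w.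
Qed.

Lemma smul_gt0 (f g : series) (v w : monomial) :
  (forall u, 0 <= f u) -> (forall u, 0 <= g u) ->
  0 < f v -> 0 < g w -> 0 < smul f g (mmul v w).
Proof.
move=> f0 g0 fv gw; rewrite (smulE _ _ (factors_refl _)).
have vF : v \in factors (mmul v w) by exact: factors_mull (factors_refl _).
have wF : w \in factors (mmul v w) by exact: factors_mulr (factors_refl _).
have ge0 (a b : monomial) : 0 <= (if mmul a b == mmul v w then f a * g b else 0).
  by case: ifP => // _; rewrite mulr_ge0.
rewrite (big_fsetD1 v) //= (big_fsetD1 w) //= eqxx -addrA ltr_wpDr ?mulr_gt0 //.
by rewrite addr_ge0 // sumr_ge0 // => a _; rewrite sumr_ge0.
Qed.

(** * Power sums and their products *)

Lemma expcmnE (v : monomial) m i : expcmn v m i = (m * v i)%N.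
Proof.
rewrite /expcmn; case: m => [|m]; first by rewrite /= onecmE.
by rewrite iteropS; elim: m => [|m IH]; rewrite ?mul1n //= mulcmE IH mulSn.
Qed.

Lemma expcmnM (v : monomial) r m : expcmn v (r * m) = expcmn (expcmn v r) m.
Proof. by apply/eqP/cmP => i; rewrite !expcmnE mulnCA mulnA. Qed.

Lemma expcmn_inj m : (0 < m)%N -> injective (@expcmn var ^~ m).
Proof.
move=> m0 v w /eqP/cmP vw; apply/eqP/cmP => i; apply/eqP.
by have /eqP := vw i; rewrite !expcmnE eqn_pmul2l.
Qed.

Lemma expX k j r (v : var) : expcmn (X k j) r v = (r * (var_of k j == v))%N.
Proof. by rewrite expcmnE ucmE. Qed.

Lemma expX_inj k r : (0 < r)%N ->
  {in [pred j | 0 < j]%N &, injective (fun j => expcmn (X k j) r)}.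
Proof.
move=> r0 i j; rewrite !inE => i0 j0 /(expcmn_inj r0) /eqP/cmP/(_ (var_of k i)).
rewrite !ucmE eqxx; case: eqP => // -[eq_ij] _.
by rewrite -(prednK i0) -(prednK j0) eq_ij.
Qed.

Lemma psum_ge0 k r u : 0 <= psum k r u.
Proof. by apply: fsumr_ge0 => j _; rewrite ler0n. Qed.

Lemma psum_neq0 k r u : psum k r u != 0 ->
  exists2 j, (0 < j)%N & u = expcmn (X k j) r.
Proof.
move=> ru.
have [j /= j0] := @fsbigN1 _ _ +%R _ _ _
  (fun (_ : unit) j => (u == expcmn (X k j) r)%:R : rat) tt ru.
by case: (u =P _) => [-> _|_]; [exists j | rewrite eqxx].
Qed.

Lemma psum_X k r j : (0 < r)%N -> (0 < j)%N -> psum k r (expcmn (X k j) r) = 1.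
Proof.
move=> r0 j0; rewrite /psum (fsbigE [:: j]) //=.
- rewrite big_mkcond big_seq1 eqxx ifT //; exact/mem_set.
- by move=> i /=; rewrite inE => /eqP->.
- move=> i /= i0; rewrite inE => ij.
  by rewrite (inj_in_eq (expX_inj r0)) ?inE // eq_sym (negPf ij).
Qed.

Lemma psum_subst k r m (v : monomial) : (0 < m)%N ->
  psum k (r * m) (expcmn v m) = psum k r v.
Proof.
move=> m0; rewrite /psum; apply: eq_fsbigr => j _.
by rewrite expcmnM (inj_eq (expcmn_inj m0)).
Qed.

Lemma subst_powE m (f : series) v : (0 < m)%N -> subst_pow m f (expcmn v m) = f v.
Proof.
move=> m0; rewrite /subst_pow.
have -> : [set w : monomial | expcmn w m = expcmn v m] = [set v].
  by apply/seteqP; split => [w /(expcmn_inj m0)|w ->].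
by rewrite fsbig_set1.
Qed.

(** For b = d^m, a monomial without m-th root has coefficient 0 on both sides,
    as psum k (r m) only involves m-th powers; at v^m both sides are P_d at v. *)
Lemma P_blockE (b : block) : (0 < b.1)%N -> (0 < b.2)%N ->
  P_block b = \big[sadd/szero]_(k <- divisors b.1)
    sscale k%:R (psum k (b.1 %/ k * b.2)).
Proof.
case: b => d m /= d0 m0; apply/funext => u; rewrite sum_series /P_block /sscale.
have [[v <-]|no_root] := pselect (exists v, expcmn v m = u).
  by rewrite subst_powE //; apply: eq_bigr => k _; rewrite psum_subst.
rewrite /subst_pow fsbig1 => [|v vu]; last by case: no_root; exists v.
rewrite big1 // => k _; have [->|/psum_neq0[j _ uX]] := eqVneq (psum k (d %/ k * m) u) 0.
  by rewrite mulr0.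
by case: no_root; exists (expcmn (X k j) (d %/ k)); rewrite -expcmnM.
Qed.

Definition pprod (bs : seq block) : series :=
  \big[smul/sone]_(b <- bs) psum b.1 b.2.

(** Listing the parts of t|_k for all k lists each block of t once. *)
Lemma big_restr (R : Type) (idx : R) (op : Monoid.com_law idx) (t : ptype)
    (F : nat -> nat -> R) :
  \big[op/idx]_(1 <= k < (maxdeg t).+1) \big[op/idx]_(r <- restr t k) F k r =
  \big[op/idx]_(b <- blocks t) F b.1 b.2.
Proof.
rewrite /restr.
under eq_bigr => k _.
  rewrite big_map big_filter big_mkcond /=.
over.
rewrite exchange_big /=; apply: eq_big_seq => b bt.
have [tP _] := andP (valP t).
have /andP[b1 _] := allP tP _ bt.
rewrite (bigD1_seq b.1) ?iota_uniq //=; last first.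
  by rewrite mem_index_iota b1 ltnS; exact: (leq_bigmax_seq (F := fst) b bt).
rewrite eqxx big1 ?Monoid.mulm1 // => k.
by rewrite eq_sym => /negPf->.
Qed.

Lemma p_tensorE (t : ptype) : p_tensor t = pprod (blocks t).
Proof. exact: big_restr. Qed.

(** * Linear independence of the tensor power sums *)

(** An entry (k, r, j) of s stands for the term x_{k,j}^r of psum k r, so s is a
    choice of one term in each factor of a product of power sums, and row_mon s
    is the product of these terms. *)
Definition row_mon (s : seq (block * nat)) : monomial :=
  \big[mmul/mone]_(p <- s) expcmn (X p.1.1 p.2) p.1.2.

Definition row_vars (s : seq (block * nat)) : seq var :=
  [seq var_of p.1.1 p.2 | p <- s].

Definition row_pos (p : block * nat) : bool :=
  [&& 0 < p.1.1, 0 < p.1.2 & 0 < p.2]%N.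

Lemma pprod_ge0 bs u : 0 <= pprod bs u.
Proof.
elim: bs u => [|b bs IH] u; rewrite /pprod ?big_nil ?big_cons; first exact: ler0n.
by apply: smul_ge0 => // v; exact: psum_ge0.
Qed.

Lemma pprod_neq0 (bs : seq block) u :
  all (fun b : block => (0 < b.1) && (0 < b.2))%N bs -> pprod bs u != 0 ->
  exists s, [/\ unzip1 s = bs, all row_pos s & u = row_mon s].
Proof.
elim: bs u => [|b bs IH] u; rewrite /pprod.
  rewrite big_nil /sone => _; case: (u =P mone) => [-> _|_]; last by rewrite eqxx.
  by exists [::]; rewrite /row_mon big_nil.
rewrite big_cons /= => /andP[/andP[b1 b2] bsP].
case/smul_neq0 => v [w] [-> /psum_neq0[j j0 ->]] /(IH _ bsP)[s [<- sP ->]].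
by exists ((b, j) :: s); rewrite /row_mon big_cons /= /row_pos /= b1 b2 j0 sP.
Qed.

Lemma pprod_gt0 s : all row_pos s -> 0 < pprod (unzip1 s) (row_mon s).
Proof.
elim: s => [|[[k r] j] s IH] /=; rewrite /pprod /row_mon ?big_nil ?big_cons.
  by rewrite /sone eqxx ltr01.
case/andP => /and3P[/= k0 r0 j0] sP.
apply: smul_gt0 (psum_ge0 k r) (pprod_ge0 _) _ (IH sP).
by rewrite psum_X ?ltr01.
Qed.

Lemma row_monE s (v : var) :
  row_mon s v = (\sum_(p <- s) p.1.2 * (var_of p.1.1 p.2 == v))%N.
Proof.
rewrite /row_mon (big_morph (fun u : monomial => u v) (id1 := 0%N) (op1 := addn)).
- by apply: eq_bigr => p _; rewrite expX.
- by move=> u w; exact: cmM.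
- exact: cm1.
Qed.

Lemma row_mon_supp s (v : var) : all row_pos s ->
  (v \in finsupp (row_mon s)) = (v \in row_vars s).
Proof.
move=> /allP sP; rewrite -cmE_neq0 row_monE sum_nat_seq_neq0.
apply/hasP/mapP => -[p ps].
  by rewrite /= muln_eq0 negb_or eqb0 negbK => /andP[_ /eqP <-]; exists p.
move=> ->; exists p => //=; rewrite eqxx muln1 -lt0n.
by have /and3P[] := sP _ ps.
Qed.

(** With distinct variables no exponents add up, so the blocks can be read off
    from the monomial. *)
Lemma row_mon_rows s : all row_pos s -> uniq (row_vars s) ->
  [seq (v.1.+1, row_mon s v) | v <- row_vars s] = unzip1 s.
Proof.
elim: s => //= -[[k r] j] s IH /andP[/and3P[/= k0 r0 j0] sP] /andP[v_notin s_uniq].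
have row_monS v : row_mon (((k, r), j) :: s) v =
    (r * (var_of k j == v) + row_mon s v)%N.
  by rewrite !row_monE big_cons.
congr (_ :: _).
  rewrite row_monS eqxx muln1 prednK //.
  by move: v_notin; rewrite -row_mon_supp // -cmE_eq0 => /eqP->; rewrite addn0.
rewrite -[RHS]IH //; apply/eq_in_map => v vs.
by congr (_, _); rewrite row_monS; case: eqP vs v_notin => [-> ->|] //; rewrite muln0.
Qed.

Lemma size_row_vars s : size (row_vars s) = size s.
Proof. exact: size_map. Qed.

(** The monomial has size s distinct variables, and s' must produce all of them;
    if it has no more entries, its variables are distinct too, and both lists of
    blocks are read off from the same monomial. *)
Lemma row_mon_size s s' : all row_pos s -> all row_pos s' ->
  uniq (row_vars s) -> row_mon s = row_mon s' ->
  (size s < size s')%N \/ perm_eq (unzip1 s) (unzip1 s').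
Proof.
move=> sP s'P s_uniq eqm.
have same_vars : row_vars s =i row_vars s'.
  by move=> v; rewrite -!row_mon_supp // eqm.
have sub_vars : {subset row_vars s <= row_vars s'} by move=> v; rewrite same_vars.
have := uniq_leq_size s_uniq sub_vars; rewrite leq_eqVlt !size_row_vars.
case/orP => [/eqP eq_size|]; [right | by left].
have s'_uniq : uniq (row_vars s').
  by rewrite -(eq_uniq _ same_vars) ?size_row_vars.
rewrite -(row_mon_rows sP s_uniq) -(row_mon_rows s'P s'_uniq) eqm.
exact/perm_map/uniq_perm.
Qed.

(** The i-th block of t gets a variable of second index i, so that different
    blocks get different variables whatever their degrees. *)
Definition lead_rows (t : ptype) : seq (block * nat) :=
  zip (blocks t) (iota 1 (size (blocks t))).

Lemma unzip_lead_rows t : unzip1 (lead_rows t) = blocks t.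
Proof. by rewrite unzip1_zip // size_iota. Qed.

Lemma lead_rows_pos t : all row_pos (lead_rows t).
Proof.
have [/allP tP _] := andP (valP t).
apply/allP => -[b j] bj.
have bt : b \in blocks t by rewrite -unzip_lead_rows; apply: (map_f fst bj).
have /andP[b1 b2] := tP _ bt; rewrite /row_pos b1 b2 /=.
suff : j \in iota 1 (size (blocks t)) by rewrite mem_iota => /andP[].
have <- : unzip2 (lead_rows t) = iota 1 (size (blocks t)) by rewrite unzip2_zip ?size_iota.
exact: (map_f snd bj).
Qed.

Lemma lead_rows_uniq t : uniq (row_vars (lead_rows t)).
Proof.
apply: (@map_uniq _ _ snd).
have -> : [seq v.2 | v <- row_vars (lead_rows t)] = iota 0 (size (blocks t)).
  rewrite -map_comp (@eq_map _ _ _ (predn \o snd)) // map_comp.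
  rewrite [map snd _]unzip2_zip ?size_iota // -(addn0 1%N) iotaDl -map_comp.
  by rewrite (@eq_map _ _ _ id) ?map_id.
exact: iota_uniq.
Qed.

Lemma block_ge_total : total block_ge.
Proof.
by move=> [a b] [c d]; rewrite /block_ge /=; case: ltngtP => //=; rewrite leq_total.
Qed.

Lemma block_ge_refl b : block_ge b b.
Proof. by have := block_ge_total b b; rewrite orbb. Qed.

Lemma block_ge_trans : transitive block_ge.
Proof.
move=> [a b] [c d] [e f]; rewrite /block_ge /=.
case: (ltngtP a c) => //= [ac _|<-].
  case: (ltngtP e a) => //= [ea _|-> _]; rewrite ?ac ?(ltn_trans ea ac) //.
by move=> db; case: ltngtP => //= _ /leq_trans; apply.
Qed.

Lemma block_ge_anti : antisymmetric block_ge.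
Proof.
move=> [a b] [c d]; rewrite /block_ge /=.
by case: ltngtP => //= -> /anti_leq ->.
Qed.

Lemma ptype_perm_inj (t t' : ptype) : perm_eq (blocks t) (blocks t') -> t = t'.
Proof.
move=> tt'; apply: val_inj.
have [_ t_sorted] := andP (valP t); have [_ t'_sorted] := andP (valP t').
exact: (sorted_eq block_ge_trans block_ge_anti).
Qed.

Lemma p_tensor_lead_neq0 (t t' : ptype) :
  p_tensor t' (row_mon (lead_rows t)) != 0 ->
  (size (blocks t) < size (blocks t'))%N \/ t = t'.
Proof.
have [t'P _] := andP (valP t').
rewrite p_tensorE => /(pprod_neq0 t'P)[s [unzip_s sP eqm]].
have [] := row_mon_size (lead_rows_pos t) sP (lead_rows_uniq t) eqm.
  by rewrite -unzip_s -[blocks t]unzip_lead_rows !size_map; left.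
by rewrite unzip_s unzip_lead_rows => /ptype_perm_inj; right.
Qed.

Lemma p_tensor_lead_gt0 (t : ptype) : 0 < p_tensor t (row_mon (lead_rows t)).
Proof. by rewrite p_tensorE -{1}unzip_lead_rows; exact/pprod_gt0/lead_rows_pos. Qed.

Lemma size_le_weight (t : ptype) : (size (blocks t) <= weight t)%N.
Proof.
have [/allP tP _] := andP (valP t).
rewrite -sum1_size /weight !big_seq; apply: leq_sum => b /tP.
by rewrite muln_gt0.
Qed.

Lemma weight_finite n : finite_set [set t : ptype | weight t = n].
Proof.
pose code := {k : 'I_n.+1 & k.-tuple ('I_n.+1 * 'I_n.+1)}.
pose decode (w : code) : ptype := insubd (@PType [::] isT)
  [seq (nat_of_ord p.1, nat_of_ord p.2) | p <- tagged w].
apply: (@sub_finite_set _ _ [set decode w | w in [set: code]]);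
  last exact/finite_image/finite_finset.
move=> t /= wt_t.
pose s : seq ('I_n.+1 * 'I_n.+1) := [seq (inord b.1, inord b.2) | b <- blocks t].
have size_s : (size s < n.+1)%N by rewrite size_map ltnS -wt_t size_le_weight.
exists (Tagged (fun k : 'I_n.+1 => k.-tuple ('I_n.+1 * 'I_n.+1)%type)
  (i := Ordinal size_s) (in_tuple s)) => //.
apply: val_inj; rewrite /decode /=.
suff -> : [seq (nat_of_ord p.1, nat_of_ord p.2) | p <- s] = blocks t.
  by rewrite insubdK //; exact: valP.
rewrite -map_comp -[RHS]map_id; apply/eq_in_map => b bt /=.
have [/allP tP _] := andP (valP t).
have /andP[b1 b2] := tP _ bt.
have le_n : (b.1 * b.2 <= n)%N.
  by rewrite -wt_t /weight (big_rem b bt) leq_addr.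
rewrite !inordK ?ltnS ?(leq_trans _ le_n) ?leq_pmulr ?leq_pmull //.
by case: (b).
Qed.

(** At the leading monomial of t only t itself and types with more blocks
    contribute. The coefficients vanish by descending induction on the number of
    blocks, which is at most n. *)
Lemma p_tensor_free n (c : ptype -> rat) :
  (forall u, \sum_(t \in [set t : ptype | weight t = n]) c t * p_tensor t u = 0) ->
  forall t, weight t = n -> c t = 0.
Proof.
move=> c0 t.
have [m] := ubnP (n - size (blocks t))%N; elim: m t => // m IH t; rewrite ltnS => lt_m wt_t.
have := c0 (row_mon (lead_rows t)).
rewrite (fsbigD1 t) //=; last exact: weight_finite.
rewrite fsbig1 ?addr0 => [/eqP|t' [wt_t' t'_neq]].
  by rewrite mulf_eq0 (gt_eqF (p_tensor_lead_gt0 t)) orbF => /eqP.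
have [->|/p_tensor_lead_neq0[lt_size|/esym //]] :=
  eqVneq (p_tensor t' (row_mon (lead_rows t))) 0; first exact: mulr0.
rewrite IH ?mul0r // (leq_trans _ lt_m) // ltn_sub2l //.
by rewrite (leq_trans lt_size) // -wt_t' size_le_weight.
Qed.

(** * Rows of the tensor diagram *)

Definition rowblock (t : ptype) (rho : trow t) : block := (comp rho, rowlen rho).

Lemma big_trow (R : Type) (idx : R) (op : Monoid.com_law idx) (t : ptype)
    (F : block -> R) :
  \big[op/idx]_(rho : trow t) F (rowblock rho) = \big[op/idx]_(b <- blocks t) F b.
Proof.
transitivity (\big[op/idx]_(b <- blocks t) F (b.1, b.2)); last first.
  by apply: eq_bigr => -[].
rewrite -(big_restr op t (fun k r => F (k, r))) big_add1 big_mkord.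
under [RHS]eq_bigr do rewrite (big_nth 0%N) big_mkord.
by rewrite sig_big_dep.
Qed.

Lemma perm_rowblocks (t : ptype) :
  perm_eq [seq rowblock rho | rho <- enum (trow t)] (blocks t).
Proof.
apply/permP => a; rewrite -!sum1_count big_mkcond [RHS]big_mkcond big_map big_enum /=.
by rewrite (big_trow _ _ (fun b => if a b then 1 else 0)%N).
Qed.

Lemma rowblock_mem (t : ptype) (rho : trow t) : rowblock rho \in blocks t.
Proof. by rewrite -(perm_mem (perm_rowblocks t)) map_f // mem_enum. Qed.

Lemma rowlen_gt0 (t : ptype) (rho : trow t) : (0 < rowlen rho)%N.
Proof.
have [/allP tP _] := andP (valP t).
by have /andP[] := tP _ (rowblock_mem rho).
Qed.

Lemma rowpos_inj (t : ptype) (rho rho' : trow t) :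
  comp rho = comp rho' -> rowpos rho = rowpos rho' -> rho = rho'.
Proof.
case: rho rho' => [k j] [k' j']; rewrite /comp /rowpos /= => -[/val_inj eq_k].
by case: _ / eq_k j' => j' /val_inj->.
Qed.

(** * Order-preserving matchings *)

(** Two finite types whose elements carry a block as key and a natural number as
    rank, with the same multiset of keys, and with distinct ranks for elements of
    equal key. When both are sorted by decreasing key, then by increasing rank,
    the lists of keys agree, and sending the i-th element to the i-th element is
    a matching. Conversely a matching carries one sorted list to a sorted list of
    all elements of the other type, which is its only sorted list. *)
Section Matching.
Variables (A C : finType) (a_key : A -> block) (c_key : C -> block).
Variables (a_rank : A -> nat) (c_rank : C -> nat).

Definition keyed_ge (T : Type) (key : T -> block) (rank : T -> nat) : rel T :=
  fun x y => block_ge (key x) (key y) && ((key x == key y) ==> (rank x <= rank y)%N).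

Definition rank_inj (T : Type) (key : T -> block) (rank : T -> nat) :=
  forall x y, key x = key y -> rank x = rank y -> x = y.

Lemma keyed_ge_total (T : Type) (key : T -> block) rank :
  total (@keyed_ge T key rank).
Proof.
move=> x y; rewrite /keyed_ge (eq_sym (key y)).
case: eqP => [->|neq] /=; last by rewrite !andbT block_ge_total.
by rewrite -andb_orr leq_total block_ge_refl.
Qed.

Lemma keyed_ge_trans (T : Type) (key : T -> block) rank :
  transitive (@keyed_ge T key rank).
Proof.
move=> y x z /andP[xy rxy] /andP[yz ryz].
rewrite /keyed_ge (block_ge_trans xy yz); apply/implyP => /eqP eq_xz.
have eq_xy : key x = key y by apply: block_ge_anti; rewrite xy /= eq_xz.
move: rxy ryz; rewrite -eq_xz eq_xy eqxx /=; exact: leq_trans.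
Qed.

Lemma keyed_ge_anti (T : Type) (key : T -> block) rank :
  rank_inj key rank -> antisymmetric (@keyed_ge T key rank).
Proof.
move=> inj x y /andP[/andP[xy rxy] /andP[yx ryx]].
have eq_xy : key x = key y by apply: block_ge_anti; rewrite xy yx.
apply: inj => //; apply: anti_leq.
by move: rxy ryx; rewrite eq_xy eqxx /= => -> ->.
Qed.

Definition order_match (f : A -> C) :=
  (forall x, c_key (f x) = a_key x) /\
  (forall x y, a_key x = a_key y -> (a_rank x <= a_rank y)%N ->
     (c_rank (f x) <= c_rank (f y))%N).

Hypothesis a_inj : rank_inj a_key a_rank.
Hypothesis c_inj : rank_inj c_key c_rank.
Hypothesis same_keys : perm_eq [seq a_key x | x <- enum A] [seq c_key y | y <- enum C].

Let a_ge := keyed_ge a_key a_rank.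
Let c_ge := keyed_ge c_key c_rank.
Let sa := sort a_ge (enum A).
Let sc := sort c_ge (enum C).

Let card_eq : #|A| = #|C|.
Proof. by have := perm_size same_keys; rewrite (size_map a_key) (size_map c_key) -!cardE. Qed.

Let sorted_keys (T : Type) (key : T -> block) rank s :
  sorted (keyed_ge key rank) s -> sorted block_ge [seq key x | x <- s].
Proof. by rewrite sorted_map; apply: sub_sorted => x y /andP[]. Qed.

Let keys_eq : [seq a_key x | x <- sa] = [seq c_key y | y <- sc].
Proof.
apply: (sorted_eq block_ge_trans block_ge_anti).
- exact/(@sorted_keys _ _ a_rank)/sort_sorted/keyed_ge_total.
- exact/(@sorted_keys _ _ c_rank)/sort_sorted/keyed_ge_total.
have sort_keys (T : eqType) (key : T -> block) le s :
    perm_eq [seq key x | x <- sort le s] [seq key x | x <- s].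
  by rewrite perm_map // perm_sort.
by rewrite (perm_trans (sort_keys _ _ _ _)) // (perm_trans same_keys) // perm_sym sort_keys.
Qed.

Lemma order_match_exists : exists f, bijective f /\ order_match f.
Proof.
(* An element of C is needed as the default value of nth below. *)
have [c0 _|C0] := pickP (predT : pred C); last first.
  have C_empty : C -> False by move=> y; have := C0 y.
  have A0 : A -> False.
    move=> x; have : (0 < #|A|)%N by apply/card_gt0P; exists x.
    by rewrite card_eq => /card_gt0P[y]; case: (C_empty y).
  exists (fun x => False_rect C (A0 x)).
  split; last by split=> x; case: (A0 x).
  by exists (fun y => False_rect A (C_empty y)) => x; [case: (A0 x) | case: (C_empty x)].
have size_s : size sa = size sc by rewrite !size_sort -!cardE.
have mem_sa x : x \in sa by rewrite mem_sort mem_enum.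
pose f x := nth c0 sc (index x sa).
have f_ix x : (index x sa < size sc)%N by rewrite -size_s index_mem.
have f_key x : c_key (f x) = a_key x.
  rewrite -(nth_map c0 (0, 0)%N) // -keys_eq (nth_map x) ?index_mem //.
  by rewrite nth_index.
exists f; split.
  apply: inj_card_bij; last by rewrite card_eq.
  move=> x y /eqP; rewrite nth_uniq // ?sort_uniq ?enum_uniq // => /eqP eq_ix.
  by rewrite -(nth_index x (mem_sa x)) eq_ix nth_index.
split=> // x y eq_xy le_xy.
have sa_sorted : sorted a_ge sa by exact/sort_sorted/keyed_ge_total.
have sc_sorted : sorted c_ge sc by exact/sort_sorted/keyed_ge_total.
have : (index x sa <= index y sa)%N.
  rewrite leqNgt; apply/negP => lt_yx.
  have a_yx : a_ge y x.
    rewrite -(nth_index x (mem_sa x)) -(nth_index x (mem_sa y)).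
    by apply: (sorted_ltn_nth (@keyed_ge_trans _ _ _)); rewrite ?inE ?index_mem.
  have a_xy : a_ge x y by rewrite /a_ge /keyed_ge eq_xy eqxx le_xy block_ge_refl.
  have eqxy : x = y by apply: (keyed_ge_anti a_inj); rewrite -/a_ge a_xy.
  by rewrite eqxy ltnn in lt_yx.
move=> /(sorted_leq_nth (@keyed_ge_trans _ _ _) _ c0 sc_sorted).
rewrite !inE !f_ix => /(_ _ isT isT) /= c_xy.
have /andP[_] : c_ge (f x) (f y).
  apply: c_xy => z; by rewrite /keyed_ge block_ge_refl leqnn implybT.
by rewrite !f_key eq_xy eqxx.
Qed.

Lemma order_match_unique f g :
  bijective f -> order_match f -> bijective g -> order_match g -> f =1 g.
Proof.
have sorted_image h : bijective h -> order_match h -> [seq h x | x <- sa] = sc.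
  move=> [h' hK h'K] [h_key h_rank].
  apply: (sorted_eq (@keyed_ge_trans _ _ _) (keyed_ge_anti c_inj)).
  - rewrite sorted_map.
    apply: sub_sorted (sort_sorted (@keyed_ge_total _ _ _) (enum A)) => x y.
    case/andP => xy rxy; rewrite /= /keyed_ge !h_key xy /=.
    by apply/implyP => /eqP eq_xy; move: rxy; rewrite eq_xy eqxx; exact: h_rank.
  - exact/sort_sorted/keyed_ge_total.
  apply: uniq_perm; first by rewrite (map_inj_uniq (can_inj hK)) sort_uniq enum_uniq.
    by rewrite sort_uniq enum_uniq.
  move=> y; rewrite mem_sort mem_enum -[y]h'K map_f //.
  by rewrite mem_sort mem_enum.
move=> f_bij f_match g_bij g_match x.
have /eq_in_map : [seq f x | x <- sa] = [seq g x | x <- sa].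
  by rewrite !sorted_image.
by apply; rewrite mem_sort mem_enum.
Qed.

End Matching.

Lemma big_divisors (R : Type) (idx : R) (op : Monoid.com_law idx) (d N : nat)
    (F : nat -> R) : (0 < d <= N)%N ->
  \big[op/idx]_(k <- divisors d) F k = \big[op/idx]_(k < N.+1 | (k %| d)%N) F k.
Proof.
case/andP => d0 dN; rewrite -(big_mkord (fun k => k %| d)%N) -[RHS]big_filter.
apply: perm_big; apply: uniq_perm; rewrite ?divisors_uniq ?filter_uniq ?iota_uniq // => k.
rewrite -dvdn_divisors // mem_filter mem_index_iota ltnS /=.
by case: (boolP (k %| d)%N) => // /(dvdn_leq d0)/leq_trans->.
Qed.

(** * Tableaux and choices of divisors *)

Section Tableaux.
Variables t s : ptype.
Local Notation I := 'I_(size (blocks s)).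

Definition sblock (i : I) : block := nth (0, 0)%N (blocks s) i.

Lemma sblock_gt0 i : (0 < (sblock i).1)%N && (0 < (sblock i).2)%N.
Proof.
have [/allP sP _] := andP (valP s).
exact/sP/mem_nth.
Qed.

Definition row_filling (f : trow t -> I) : filling t s := [ffun x => f (cellrow x)].

Definition first_cell (rho : trow t) : cell t :=
  Tagged (fun rho : trow t => 'I_(rowlen rho)) (Ordinal (rowlen_gt0 rho)).

Lemma row_filling_first f rho : row_filling f (first_cell rho) = f rho.
Proof. by rewrite ffunE. Qed.

Lemma eq_row_filling f g : f =1 g -> row_filling f = row_filling g.
Proof. by move=> fg; apply/ffunP => x; rewrite !ffunE fg. Qed.

Lemma constant_rowsP (T : filling t s) :
  reflect (exists f, T = row_filling f) (constant_rows T).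
Proof.
apply: (iffP idP) => [/forallP T_const|[f ->]].
  exists (T \o first_cell); apply/ffunP => x; rewrite ffunE /=; apply/eqP.
  by have /forallP/(_ (first_cell (cellrow x)))/implyP := T_const x; apply.
by apply/forallP => x; apply/forallP => y; apply/implyP => /eqP xy; rewrite !ffunE xy.
Qed.

Lemma rows_with_filling f i :
  rows_with (row_filling f) i = [set rho | f rho == i]%SET.
Proof.
apply/setP => rho; rewrite inE; apply/imsetP/idP => [[x]|f_rho].
  by rewrite inE ffunE => x_i ->.
by exists (first_cell rho); rewrite ?inE ?row_filling_first.
Qed.

(** The conditions on a tableau of shape t and content s, stated for the function
    that sends a row to its value. *)
Definition icr_rows (f : trow t -> I) : Prop :=
  [/\ bijective f,
      forall rho, (comp rho %| (sblock (f rho)).1)%N,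
      forall rho, (rowlen rho * comp rho = (sblock (f rho)).1 * (sblock (f rho)).2)%N
    & forall rho rho', rowblock rho = rowblock rho' ->
        (rowpos rho <= rowpos rho')%N -> (f rho <= f rho')%N].

Lemma ICRPT_filling f : row_filling f \in ICRPT t s <-> icr_rows f.
Proof.
rewrite inE; have -> : constant_rows (row_filling f) by apply/constant_rowsP; exists f.
rewrite andTb; split=> [/andP[content incr] | [f_bij f_dvd f_area f_incr]].
  have contentP i : exists rho, [/\ [set r | f r == i]%SET = [set rho]%SET,
      (comp rho %| (sblock i).1)%N & (rowlen rho * comp rho = (sblock i).1 * (sblock i).2)%N].
    have /existsP[rho] := forallP content i; rewrite rows_with_filling.
    rewrite -/(sblock i); case: (sblock i) => d m /and3P[/eqP? ? /eqP?].
    by exists rho.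
  have row_uniq rho i : f rho = i -> forall rho',
      [set r | f r == i]%SET = [set rho']%SET -> rho = rho'.
    by move=> f_rho rho' /setP/(_ rho); rewrite !inE f_rho eqxx => /esym/eqP.
  split.
  - have [g gP] := choice contentP.
    exists g => [rho|i].
      by have [/row_uniq-/(_ rho erefl)] := gP (f rho).
    by have [/setP/(_ (g i))] := gP i; rewrite !inE eqxx => /eqP.
  - by move=> rho; have [rho' [/row_uniq-/(_ rho erefl)->]] := contentP (f rho).
  - by move=> rho; have [rho' [/row_uniq-/(_ rho erefl)->]] := contentP (f rho).
  move=> rho rho' eq_block le_pos.
  have /forallP/(_ (first_cell rho'))/implyP := forallP incr (first_cell rho).
  rewrite !row_filling_first; apply; apply/and5P; split=> //; apply/eqP.
    exact: (congr1 fst eq_block).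
  exact: (congr1 snd eq_block).
have [g fK gK] := f_bij.
apply/andP; split.
  apply/forallP => i; apply/existsP; exists (g i).
  have := f_dvd (g i); have := f_area (g i); rewrite gK rows_with_filling -/(sblock i).
  case: (sblock i) => d m /= -> ->; rewrite eqxx !andbT; apply/eqP/setP => rho.
  by rewrite !inE (can2_eq fK gK).
apply/forallP => x; apply/forallP => y; apply/implyP.
case/and5P => _ _ /eqP eq_comp /eqP eq_len le_pos; rewrite !ffunE.
by apply: f_incr => //; rewrite /rowblock eq_comp eq_len.
Qed.

(** One range for the divisors of all degrees makes the choices plain finite
    functions; that kappa i divides the i-th degree is the predicate dvd_choice
    below. *)
Definition divisor_choice : finType := {ffun I -> 'I_(maxdeg s).+1}.

Definition choice_block (kappa : divisor_choice) (i : I) : block :=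
  (nat_of_ord (kappa i), (sblock i).1 %/ kappa i * (sblock i).2)%N.

Definition dvd_choice : pred divisor_choice :=
  [pred kappa in family (fun i (k : 'I_(maxdeg s).+1) => k %| (sblock i).1)%N].

Definition choice_blocks (kappa : divisor_choice) : seq block :=
  [seq choice_block kappa i | i <- enum I].

Lemma sblock_le_maxdeg i : ((sblock i).1 <= maxdeg s)%N.
Proof. exact: (leq_bigmax_seq (F := fst) (sblock i) (mem_nth _ (ltn_ord i))). Qed.

Lemma P_expansion : P_ s =
  \big[sadd/szero]_(kappa | dvd_choice kappa)
    sscale (\prod_i (kappa i : nat)%:R) (pprod (choice_blocks kappa)).
Proof.
rewrite /P_ (big_nth (0, 0)%N) big_mkord.
under [LHS]eq_bigr => i _.
  have /andP[d0 m0] := sblock_gt0 i.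
  rewrite (P_blockE d0 m0).
  rewrite (@big_divisors _ _ _ _ (maxdeg s)) ?d0 ?sblock_le_maxdeg //.
over.
rewrite bigA_distr_big_dep; apply: eq_bigr => kappa _.
rewrite prod_scale; congr (sscale _ _).
by rewrite /pprod big_map big_enum.
Qed.

(** The component of the row of value i, written as a sum over a set of rows
    that is a singleton when f is a bijection. The bound maxdeg s is large enough
    because the component divides the degree of a block of s. *)
Definition row_choice (f : trow t -> I) : divisor_choice :=
  [ffun i => inord (\sum_(rho | f rho == i) comp rho)].

Section ICRrows.
Variable (f : trow t -> I).
Hypothesis fP : icr_rows f.

Lemma row_choiceE rho : row_choice f (f rho) = comp rho :> nat.
Proof.
have [f_bij f_dvd _ _] := fP.
rewrite ffunE (big_pred1 rho); last by move=> rho'; rewrite (inj_eq (bij_inj f_bij)).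
rewrite inordK // ltnS (leq_trans _ (sblock_le_maxdeg (f rho))) //.
by rewrite dvdn_leq //; have /andP[] := sblock_gt0 (f rho).
Qed.

Lemma choice_block_row rho : choice_block (row_choice f) (f rho) = rowblock rho.
Proof.
have [_ f_dvd f_area _] := fP.
rewrite /choice_block row_choiceE; congr (_, _).
have /dvdnP[q def_d] := f_dvd rho; have := f_area rho; rewrite def_d mulnK //.
by rewrite mulnAC => /eqP; rewrite eqn_pmul2r // => /eqP.
Qed.

Lemma row_choice_dvd : dvd_choice (row_choice f).
Proof.
have [[g fK gK] f_dvd _ _] := fP.
by apply/familyP => i; rewrite unfold_in -[i]gK row_choiceE f_dvd.
Qed.

(** Through the bijection f, the blocks of the choice are the (component, length)
    pairs of the rows. *)
Lemma row_choice_blocks : perm_eq (choice_blocks (row_choice f)) (blocks t).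
Proof.
have [[g fK gK] _ _ _] := fP.
rewrite -(permPr (perm_rowblocks t)) perm_sym.
rewrite -(eq_map choice_block_row) map_comp perm_map //.
apply: uniq_perm; rewrite ?(map_inj_uniq (can_inj fK)) ?enum_uniq // => i.
by rewrite mem_enum -[i]gK map_f // mem_enum.
Qed.

Lemma icr_order_match :
  order_match (@rowblock t) (choice_block (row_choice f)) (@rowpos t) (@nat_of_ord _) f.
Proof. by have [_ _ _ f_incr] := fP; split; [exact: choice_block_row | exact: f_incr]. Qed.

(** Both sides are the product of the components of all rows. *)
Lemma wt_filling :
  ((wt (row_filling f))%:R = \prod_i (row_choice f i : nat)%:R :> rat).
Proof.
have [f_bij _ _ _] := fP.
rewrite (reindex f) /=; last exact/onW_bij.
rewrite -natr_prod; congr (_%:R).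
under [RHS]eq_bigr do rewrite row_choiceE.
rewrite /wt big_add1 big_mkord (partition_big (@tag _ _) xpredT) //=.
apply: eq_bigr => k _; rewrite /nrows -prod_nat_const /comp.
apply: eq_big => rho; first by rewrite inE /= eqSS.
by rewrite inE => /eqP.
Qed.
End ICRrows.

Lemma rowpos_rank_inj : rank_inj (@rowblock t) (@rowpos t).
Proof. by move=> rho rho' eq_block; exact: (rowpos_inj (congr1 fst eq_block)). Qed.

Lemma icr_rows_inj f g : icr_rows f -> icr_rows g ->
  row_choice f = row_choice g -> f =1 g.
Proof.
move=> fP gP eq_fg; have [f_bij _ _ _] := fP; have [g_bij _ _ _] := gP.
have f_match := icr_order_match fP; have g_match := icr_order_match gP.
rewrite -eq_fg in g_match.
by apply: order_match_unique f_bij f_match g_bij g_match => i j _; exact: val_inj.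
Qed.

Lemma icr_rows_exist kappa : dvd_choice kappa ->
  perm_eq (choice_blocks kappa) (blocks t) ->
  exists2 f, icr_rows f & row_choice f = kappa.
Proof.
move=> /familyP kappa_dvd same_blocks.
have [] := @order_match_exists (trow t) I (@rowblock t) (choice_block kappa)
  (@rowpos t) (@nat_of_ord _).
- exact: rowpos_rank_inj.
- by rewrite (permPl (perm_rowblocks t)) perm_sym.
move=> f [f_bij [f_key f_incr]].
have kappa_f rho : kappa (f rho) = comp rho :> nat by have [] := f_key rho.
have fP : icr_rows f.
  split=> // rho; first by have := kappa_dvd (f rho); rewrite unfold_in kappa_f.
  have [_ <-] := f_key rho; rewrite kappa_f mulnAC divnK //.
  by have := kappa_dvd (f rho); rewrite unfold_in kappa_f.
exists f => //; apply/ffunP => i; apply: val_inj.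
have [g fK gK] := f_bij.
by rewrite /= -[i]gK row_choiceE // kappa_f.
Qed.

(** Sending a tableau to its choice of divisors is a bijection onto the choices
    whose blocks are those of t, and it turns the weight into the product. *)
Lemma sum_ICRPT :
  \sum_(T in ICRPT t s) (wt T)%:R =
  \sum_(kappa | dvd_choice kappa && perm_eq (choice_blocks kappa) (blocks t))
    \prod_i (kappa i : nat)%:R :> rat.
Proof.
pose h (T : filling t s) := row_choice (T \o first_cell).
have h_filling f : h (row_filling f) = row_choice f.
  apply/ffunP => i; rewrite !ffunE; congr inord; apply: eq_bigl => rho.
  by rewrite /= row_filling_first.
have ICRPT_rows T : T \in ICRPT t s -> exists2 f, T = row_filling f & icr_rows f.
  move=> T_icr; have : constant_rows T by have := T_icr; rewrite inE => /and3P[].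
  by case/constant_rowsP => f def_T; exists f => //; apply/ICRPT_filling; rewrite -def_T.
transitivity (\sum_(T in ICRPT t s) \prod_i (h T i : nat)%:R : rat).
  by apply: eq_bigr => T /ICRPT_rows[f -> fP]; rewrite h_filling wt_filling.
rewrite -(big_imset (h := h)
  (fun kappa : divisor_choice => \prod_i (kappa i : nat)%:R)) /=; last first.
  move=> T T' /ICRPT_rows[f -> fP] /ICRPT_rows[g -> gP]; rewrite !h_filling => eq_fg.
  exact/eq_row_filling/icr_rows_inj.
apply: eq_bigl => kappa; apply/imsetP/andP => [[T /ICRPT_rows[f -> fP] ->]|].
  by rewrite h_filling row_choice_dvd ?row_choice_blocks.
case=> kappa_dvd /(icr_rows_exist kappa_dvd)[f fP <-].
by exists (row_filling f); rewrite ?h_filling //; apply/ICRPT_filling.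
Qed.

End Tableaux.

(** * The coefficients of P *)

Definition ptype_of (bs : seq block) : ptype := insubd (@PType [::] isT) (sort block_ge bs).

Lemma ptype_of_perm (bs : seq block) :
  all (fun b : block => (0 < b.1) && (0 < b.2))%N bs ->
  perm_eq bs (blocks (ptype_of bs)).
Proof.
move=> bsP; have sort_bs : sort block_ge bs \in is_ptype.
  by rewrite unfold_in /is_ptype all_sort bsP sort_sorted //; exact: block_ge_total.
have -> : blocks (ptype_of bs) = sort block_ge bs by exact: insubdK sort_bs.
by rewrite perm_sym perm_sort.
Qed.

Definition choice_coef (s t : ptype) : rat :=
  \sum_(kappa : divisor_choice s |
      dvd_choice kappa && perm_eq (choice_blocks kappa) (blocks t))
    \prod_i (kappa i : nat)%:R.

Lemma choice_block_gt0 (s : ptype) (kappa : divisor_choice s) i : dvd_choice kappa ->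
  (0 < (choice_block kappa i).1)%N && (0 < (choice_block kappa i).2)%N.
Proof.
move=> /familyP/(_ i); rewrite unfold_in => k_dvd /=.
have /andP[d0 m0] := sblock_gt0 i.
have k0 := dvdn_gt0 d0 k_dvd.
by rewrite k0 muln_gt0 m0 divn_gt0 // dvdn_leq.
Qed.

Lemma choice_weight (s : ptype) (kappa : divisor_choice s) : dvd_choice kappa ->
  (\sum_(b <- choice_blocks kappa) b.1 * b.2 = weight s)%N.
Proof.
move=> /familyP kappa_dvd; rewrite /weight.
rewrite [RHS](big_nth (0, 0)%N) big_mkord big_map big_enum /=.
apply: eq_bigr => i _; have := kappa_dvd i; rewrite unfold_in -/(sblock i) => k_dvd.
by rewrite mulnA (mulnC (kappa i : nat)) divnK.
Qed.

(** Grouping the terms of P_expansion by their type: a choice contributes to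
    exactly one type, which has the weight of s. *)
Lemma choice_coef_expansion (s : ptype) :
  is_p_tensor_expansion (weight s) (P_ s) (choice_coef s).
Proof.
move=> u; rewrite P_expansion sum_series fsbig_finite; last exact: weight_finite.
rewrite /choice_coef; under [RHS]eq_bigr do rewrite mulr_suml big_mkcondr /=.
rewrite exchange_big /=; apply: eq_bigr => kappa kappa_dvd.
set t := ptype_of (choice_blocks kappa).
have kt : perm_eq (choice_blocks kappa) (blocks t).
  apply: ptype_of_perm; apply/allP => _ /mapP[i _ ->]; exact: choice_block_gt0.
have wt_t : weight t = weight s by rewrite /weight -(perm_big _ kt) choice_weight.
rewrite (bigD1_seq t) ?fset_uniq //=; last first.
  by rewrite in_fset_set; [exact/mem_set | exact: weight_finite].
rewrite kt [X in _ + X]big1 ?addr0 => [|t' t'_neq]; last first.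
  case: ifP => // kt'; case/eqP: t'_neq; apply: ptype_perm_inj.
  by rewrite -(permPl kt').
by rewrite p_tensorE /sscale /pprod (perm_big _ kt).
Qed.

(** By linear independence, two functions with the expansion property agree at
    the types of the weight of s. *)
Lemma transitionE (t s : ptype) : weight t = weight s -> transition t s = choice_coef s t.
Proof.
move=> wt_t; rewrite /transition.
set E := [set c | _]; set c := xget _ E.
have c_exp : E c by apply: (xgetI _ (choice_coef_expansion s)).
apply/eqP; rewrite -subr_eq0; apply/eqP.
apply: (@p_tensor_free (weight s) (fun t => c t - choice_coef s t)) => // u.
transitivity (P_ s u - P_ s u); last exact: subrr.
rewrite [in X in X - _]c_exp [in X in _ - X](choice_coef_expansion s).
have fin := @weight_finite (weight s).
rewrite !fsbig_finite //= -sumrB; apply: eq_bigr => t' _; exact: mulrBl.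
Qed.

Theorem corollary41 (n : nat) (sigma tau : ptype)
    (hsigma : weight sigma = n) (htau : weight tau = n) :
  transition tau sigma = \sum_(T in ICRPT tau sigma) (wt T)%:R.
Proof. by rewrite transitionE ?htau // sum_ICRPT. Qed.
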